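(* Let $p:\mathbb{R}^+\to[1,\infty)$ and let $w$ be a weight on $\mathbb{R}^+$. Assume there exists a constant $1\le C_0<\infty$ such that $$\int_0^\infty \big(T_\phi f(x)\big)^{p(x)}\,w(x)\,dx\le C_0\int_0^\infty f(x)^{p(x)}\,w(x)\,dx$$ holds for every $f\in\mathcal{D}$. Then for every $f\in\mathcal{D}$ with $\|f\|_{p(x),w}\ge 1/C_0$ we have $$\|T_\phi f\|_{p(x),w}\le C_0\,\|f\|_{p(x),w}.$$
   Context: $\mathbb{R}^+=(0,\infty)$. All functions are assumed measurable (including $p$, $\phi$, $w$). All constants in inequalities are positive and finite. A weight is a non-negative measurable locally integrable function $w$ on $\mathbb{R}^+$. Let $\mathcal{D}$ be the set of non-negative non-increasing functions $f$ on $\mathbb{R}^+$ with $f(0+)\le 1$. The Luxemburg norm is $$\|f\|_{p(x),w}:=\inf\Big\{\lambda>0:\int_{\mathbb{R}^+}\Big(\frac{|f(x)|}{\lambda}\Big)^{p(x)}w(x)\,dx\le 1\Big\},$$ with $\inf\emptyset=\infty$. Let $\phi:\mathbb{R}^+\times\mathbb{R}^+\to[0,\infty)$ and define $$T_\phi f(x):=\int_0^x\phi(x,y)f(y)\,dy,\qquad \Phi(x,r):=\int_0^r\phi(x,y)\,dy.$$ Standing assumptions on $\phi$: P1. There is a constant $B>1$ such that $\Phi(x,r)\le B\,\Phi(x,t)\,\Phi(t,r)$ for all $0<r\le t\le x$. P2. $T_\phi f$ is non-increasing whenever $f$ is non-negative and non-increasing. P3. $\Phi(x,x)\le 1$ for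 all $x>0$. *)

(* Defs.v *)
From HB Require Import structures.
From mathcomp Require Import all_boot all_order all_algebra.
From mathcomp Require Import all_classical all_reals all_analysis.
From mathcomp Require Import measurable_realfun.
Set Implicit Arguments.
Unset Strict Implicit.
Unset Printing Implicit Defensive.
Import Order.TTheory GRing.Theory Num.Theory.
Import numFieldNormedType.Exports.
Local Open Scope classical_set_scope.
Local Open Scope ring_scope.

(* A function on R^+ = (0, +oo) is represented by a function on R of which only
   the values at positive points are used. *)
Definition Rplus {R : realType} : set R := `]0, +oo[%classic.

Definition nonneg_on_Rplus {R : realType} (f : R -> R) : Prop :=
  forall x, Rplus x -> 0 <= f x.

Definition nonincreasing_on_Rplus {R : realType} {d : Order.disp_t}
    {U : porderType d} (f : R -> U) : Prop :=
  forall x y, Rplus x -> Rplus y -> x <= y -> (f y <= f x)%O.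

(* Lebesgue measurability: the type ascription replaces the Borel sigma-algebra,
   which is the default one on R, by the domain of completed_lebesgue_measure. *)
Definition lebesgue_measurable_fun {R : realType} (D : set R) (f : R -> R) :
    Prop :=
  measurable_fun (D : set (caratheodory_type (mu_ext (wlength (@idfun R))))) f.

(* The Lebesgue sigma-algebra of the plane is the completion of the product of
   those of the line. *)
Definition lebesgue_measurable_fun2 {R : realType} (D : set (R * R))
    (f : R -> R -> R) : Prop :=
  forall Y : set R, measurable Y ->
    completed_algebra_gen
      (@completed_lebesgue_measure R \x @completed_lebesgue_measure R)%E
      (D `&` [set z | Y (f z.1 z.2)]).

(* locally_integrable from the library is not used since it asks for Borel
   measurability. *)
Definition weight {R : realType} (w : R -> R) : Prop :=
  [/\ nonneg_on_Rplus w, lebesgue_measurable_fun Rplus w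
    & forall K : set R, K `<=` Rplus -> compact K ->
        (\int[@completed_lebesgue_measure R]_(x in K) `|w x|%:E < +oo)%E].

(* Measurability is automatic for a monotone function. *)
Definition classD {R : realType} : set (R -> R) :=
  [set f | [/\ nonneg_on_Rplus f, nonincreasing_on_Rplus f
             & exists2 l : R, f x @[x --> 0^'+] --> l & l <= 1]].

Definition modular {R : realType} (p w : R -> R) (f : R -> \bar R) : \bar R :=
  (\int[@completed_lebesgue_measure R]_(x in Rplus) ((`|f x| `^ p x) * (w x)%:E))%E.

(* ereal_inf set0 = +oo, as in the convention inf(empty) = oo. *)
Definition luxemburg {R : realType} (p w : R -> R) (f : R -> \bar R) : \bar R :=
  ereal_inf [set l%:E | l in [set l : R | 0 < l /\
    (modular p w (fun x => `|f x| * (l^-1)%:E) <= 1)%E]].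

Definition Tphi {R : realType} (phi : R -> R -> R) (f : R -> R) (x : R) :
    \bar R :=
  (\int[@completed_lebesgue_measure R]_(y in `]0%R, x[) (phi x y * f y)%:E)%E.

Definition Phi {R : realType} (phi : R -> R -> R) (x r : R) : \bar R :=
  (\int[@completed_lebesgue_measure R]_(y in `]0%R, r[) (phi x y)%:E)%E.

Definition kernel_on_Rplus {R : realType} (phi : R -> R -> R) : Prop :=
  (forall x y, Rplus x -> Rplus y -> 0 <= phi x y) /\
  lebesgue_measurable_fun2 (Rplus `*` Rplus) phi.

Definition P1 {R : realType} (phi : R -> R -> R) : Prop :=
  exists2 B : R, 1 < B & forall r t x : R, 0 < r -> r <= t -> t <= x ->
    (Phi phi x r <= B%:E * Phi phi x t * Phi phi t r)%E.

Definition P2 {R : realType} (phi : R -> R -> R) : Prop :=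
  forall f : R -> R, nonneg_on_Rplus f -> nonincreasing_on_Rplus f ->
    nonincreasing_on_Rplus (Tphi phi f).

Definition P3 {R : realType} (phi : R -> R -> R) : Prop :=
  forall x : R, 0 < x -> (Phi phi x x <= 1)%E.

(* Main.v *)
Require Import Defs.
From mathcomp Require Import all_boot all_order all_algebra.
From mathcomp Require Import all_classical all_reals all_analysis.
Import Order.TTheory GRing.Theory Num.Theory.
Import numFieldNormedType.Exports.
Local Open Scope classical_set_scope.
Local Open Scope ring_scope.

(** The inequality between modulars becomes an inequality between Luxemburg
    norms by testing it on a rescaled function.  Let [l] be admissible in the
    infimum defining the norm of [f].  The hypothesis on that norm gives
    [1 <= C0 * l], so [g = f / (C0 * l)] lies below [f], hence still in the
    class [classD], and the assumed inequality applies to [g].  As [p >= 1] and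
    [C0 >= 1], shrinking a function by the factor [C0^-1] shrinks its modular
    by at least that factor ([le_modular_contraction]); therefore

      [modular (T g) <= C0 * modular (f / l / C0) <= modular (f / l) <= 1].

    Since [T f / (C0 * l) = T g] by homogeneity ([Tphi_le_scale] is the
    inequality that matters), [C0 * l] is admissible for [T f].  Taking the
    infimum over [l] concludes. *)

(** The integral of an arbitrary non-negative function is the supremum over the
    simple functions below it, and multiplying these by [k^-1] sends the ones
    below [f] to ones below [g].  The argument covers [Tphi phi f], whose
    integrand is only known to be measurable for almost every value of the outer
    variable. *)
Lemma ge0_le_integral_scale {d} {T : measurableType d} {R : realType}
    (mu : {measure set T -> \bar R}) (D : set T) (f g : T -> \bar R) (k : R) :
    0 < k ->
    (forall x, D x -> (0 <= f x)%E) -> (forall x, D x -> (0 <= g x)%E) ->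
    (forall x, D x -> (f x <= k%:E * g x)%E) ->
  (\int[mu]_(x in D) f x <= k%:E * \int[mu]_(x in D) g x)%E.
Proof.
move=> k0 f0 g0 fg; rewrite !ge0_integralE//.
have ki0 : 0 <= k^-1 by rewrite invr_ge0 ltW.
apply: ge_ereal_sup => _ [h /= hf <-].
rewrite -lee_pdivrMl// -sintegralrM.
apply: ereal_sup_ubound; exists (scale_nnsfun h ki0) => //= x.
rewrite EFinM lee_pdivrMl// (le_trans (hf x))//.
rewrite !patchE; case: ifPn => [/set_mem/fg//|_].
by rewrite mule0.
Qed.

(** The exponents being at least [1], a pointwise factor [k <= 1] raised to the
    power [p x] is at most [k], and so comes out of the modular. *)
Lemma le_modular_contraction {R : realType} (p w : R -> R) (u v : R -> \bar R)
    (k : R) :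
    (forall x, Rplus x -> 1 <= p x) -> nonneg_on_Rplus w ->
    0 < k -> k <= 1 ->
    (forall x, Rplus x -> (`|u x| <= k%:E * `|v x|)%E) ->
  (modular p w u <= k%:E * modular p w v)%E.
Proof.
move=> p1 w0 k0 k1 uv; apply: ge0_le_integral_scale => // x Rx.
- by rewrite mule_ge0 ?poweR_ge0 ?lee_fin ?w0.
- by rewrite mule_ge0 ?poweR_ge0 ?lee_fin ?w0.
rewrite muleA lee_wpmul2r ?lee_fin ?w0//.
have p0 : 0 <= p x by rewrite (le_trans _ (p1 _ Rx)).
apply: (@le_trans _ _ ((k%:E * `|v x|) `^ p x)%E).
  apply: gt0_ler_poweR => //; rewrite ?in_itv/= ?leey ?andbT ?uv//.
  by rewrite mule_ge0// lee_fin ltW.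
rewrite poweRM ?lee_fin ?(ltW k0)// lee_wpmul2r ?poweR_ge0//.
rewrite poweR_EFin lee_fin -[leRHS]powRr1 ?(ltW k0)//.
by rewrite ger_powR ?k0 ?p1.
Qed.

Lemma Tphi_ge0 {R : realType} (phi : R -> R -> R) (f : R -> R) (x : R) :
    (forall x y, Rplus x -> Rplus y -> 0 <= phi x y) -> nonneg_on_Rplus f ->
  Rplus x -> (0 <= Tphi phi f x)%E.
Proof.
move=> phi0 f0 Rx; apply: integral_ge0 => y /=; rewrite in_itv/= => /andP[y0 _].
have Ry : Rplus y by rewrite /Rplus/= in_itv/= y0.
by rewrite lee_fin mulr_ge0 ?phi0 ?f0.
Qed.

Lemma Tphi_le_scale {R : realType} (phi : R -> R -> R) (f g : R -> R) (k x : R) :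
    (forall x y, Rplus x -> Rplus y -> 0 <= phi x y) ->
    nonneg_on_Rplus f -> nonneg_on_Rplus g -> 0 < k ->
    (forall y, Rplus y -> f y <= k * g y) ->
  Rplus x -> (Tphi phi f x <= k%:E * Tphi phi g x)%E.
Proof.
move=> phi0 f0 g0 k0 fg Rx; have RP y : `]0, x[%classic y -> Rplus y.
  by rewrite /Rplus/= !in_itv/= => /andP[->].
apply: ge0_le_integral_scale => // y /RP Ry; rewrite lee_fin.
- by rewrite mulr_ge0 ?phi0 ?f0.
- by rewrite mulr_ge0 ?phi0 ?g0.
- by rewrite mulrCA ler_wpM2l ?phi0 ?fg.
Qed.

Lemma classD_divr {R : realType} (f : R -> R) (k : R) :
  1 <= k -> classD f -> classD (fun x => f x / k).
Proof.
move=> k1 [f0 fni [l fl l1]].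
have k0 : 0 < k by rewrite (lt_le_trans _ k1).
split.
- by move=> x Rx; rewrite mulr_ge0 ?f0// invr_ge0 ltW.
- move=> x y Rx Ry xy; rewrite ler_pM2r ?invr_gt0//.
  exact: fni xy.
- exists (l / k); first exact: cvgMl.
  by rewrite ler_pdivrMr// mul1r (le_trans l1).
Qed.

Theorem theorem3p4 (R : realType) (phi : R -> R -> R)
    (hphi : kernel_on_Rplus phi) (hP1 : P1 phi) (hP2 : P2 phi) (hP3 : P3 phi)
    (p w : R -> R)
    (hp_meas : lebesgue_measurable_fun Rplus p) (hp : forall x, Rplus x -> 1 <= p x)
    (hw : weight w)
    (C0 : R) (hC0 : 1 <= C0)
    (hmod : forall f : R -> R, classD f ->
      (modular p w (Tphi phi f) <= C0%:E * modular p w (EFin \o f))%E) :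
  forall f : R -> R, classD f ->
    ((C0^-1)%:E <= luxemburg p w (EFin \o f))%E ->
    (luxemburg p w (Tphi phi f) <= C0%:E * luxemburg p w (EFin \o f))%E.
Proof.
move=> f fD Cf; have [phi0 _] := hphi; have [w0 _ _] := hw.
have [f0 _ _] := fD.
have C_gt0 : 0 < C0 by rewrite (lt_le_trans _ hC0).
rewrite [X in (_ <= _ * X)%E]/luxemburg -ereal_inf_pZl//.
apply: le_ereal_inf_tmp => _ [_ [l [l0 fl1] <-] <-]; rewrite -EFinM.
have Cl1 : 1 <= C0 * l.
  rewrite -ler_pdivrMl// mulr1 -lee_fin (le_trans Cf)//.
  by apply: ereal_inf_lbound; exists l.
have Cl0 : 0 < C0 * l by rewrite (lt_le_trans _ Cl1).
apply: ereal_inf_lbound; exists (C0 * l) => //; split => //.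
have gD := classD_divr f _ Cl1 fD; have [g0 _ _] := gD.
set g := (fun x => f x / (C0 * l)) in gD g0.
apply: (@le_trans _ _ (modular p w (Tphi phi g))).
  rewrite -[leRHS]mul1e; apply: le_modular_contraction => // x Rx.
  rewrite mul1e !gee0_abs ?mule_ge0 ?Tphi_ge0 ?lee_fin ?invr_ge0 ?(ltW Cl0)//.
  rewrite lee_pdivrMr// muleC; apply: Tphi_le_scale => // y _.
  by rewrite mulrC divfK// gt_eqF.
apply: (le_trans (hmod g gD)); apply: le_trans fl1.
rewrite -lee_pdivlMl//; apply: le_modular_contraction => //.
- by rewrite invr_gt0.
- by rewrite invf_le1.
move=> x Rx /=; rewrite -!EFinM lee_fin.
rewrite !normrM normr_id !normfV (gtr0_norm Cl0) (gtr0_norm l0) invfM.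
by rewrite mulrCA.
Qed.
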